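(* Let $\gamma\in\mathcal M_g$ with monodromy $g=(R,\vec b)\in\mathrm{SE}(3)$, where $g$ is not a pure half-turn and the origin is chosen on the screw axis of $g$ if $R\neq\mathrm{Id}$. Let $h=(Q,\vec c)\in Z(g)$. Then: (i) If $g=\mathrm{id}$, any $h\in\mathrm{SE}(3)$ is allowed and $$\mathscr A(h\circ\gamma)=Q\mathscr A(\gamma),\qquad \mathscr V(h\circ\gamma)=Q\mathscr V(\gamma)+\vec c\times Q\mathscr A(\gamma).$$ (ii) If $R=\mathrm{Id}$ and $\vec b\neq0$, then $\vec s_g=\vec b/|\vec b|$, and $h=(Q,\vec c)\in Z(g)$ has $Q\vec s_g=\vec s_g$ with $\vec c\in\mathbb R^3$ arbitrary. Writing $\vec c^\perp=\vec c-\langle\vec s_g,\vec c\rangle\vec s_g$, $$\mathscr A(h\circ\gamma)=Q\mathscr A(\gamma)+\vec c\times\vec b,$$ $$\langle\vec s_g,\mathscr V(h\circ\gamma)\rangle=\langle\vec s_g,\,Q\mathscr V(\gamma)+\vec c\times Q\mathscr A(\gamma)\rangle-\tfrac12|\vec b|\,|\vec c^\perp|^2 .$$ When the translation preserves the axis $\vec s_g$ (i.e. $\vec c\parallel\vec s_g$), the two additional terms $\vec c\times\vec b$ and $-\tfrac12|\vec b||\vec c^\perp|^2$ vanish. (iii) If $R\neq\mathrm{Id}$, $h$ must be a screw motion about the axis $\mathbb R\vec s_g$ (i.e. $Q\vec s_g=\vec s_g$ and $\vec c\parallel\vec s_g$), and the axial projections transform as $$\langle\vec s_g,\mathscr A(h\circ\gamma)\rangle=\langle\vec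 s_g,Q\mathscr A(\gamma)\rangle,\qquad \langle\vec s_g,\mathscr V(h\circ\gamma)\rangle=\langle\vec s_g,\,Q\mathscr V(\gamma)+\vec c\times Q\mathscr A(\gamma)\rangle .$$
   Context: Fix a translation $\tau:\mathbb R\to\mathbb R$, $\tau(t)=t+T_0$ with $T_0>0$. An element $g=(R,\vec b)\in\mathrm{SE}(3)$, $R\in \mathrm{SO}(3)$, $\vec b\in\mathbb R^3$, acts by $g(\vec x)=R\vec x+\vec b$. $\mathcal M_g$ is the space of smooth immersions $\gamma:\mathbb R\to\mathbb R^3$ with $\gamma(\tau(t))=g(\gamma(t))$ for all $t$ ($\vec\gamma$ denotes the corresponding vector-valued function). $Z(g)=\{h\in\mathrm{SE}(3): hg=gh\}$ is the centralizer; it acts on $\mathcal M_g$ by $\gamma\mapsto h\circ\gamma$. A pure half-turn is a rotation by angle $\pi$ about an axis with no translation along it. If $R\ne\mathrm{Id}$, the origin is chosen on the screw axis of $g$, so that $R\vec b=\vec b$; $\vec s_g$ is a unit vector with $R\vec s_g=\vec s_g$, and $\vec b$ is parallel to $\vec s_g$. With $ds$ the arc-length measure and $'$ the arc-length derivative, on a fundamental domain $I=[t_0,\tau(t_0)]$: $\mathscr A(\gamma)=\tfrac12\int_I\vec\gamma\times\vec\gamma'\,ds-\tfrac12\vec b\times\vec\gamma(t_0)$ (area vector), $\mathscr V(\gamma)=\tfrac13\int_I\vec\gamma\times(\vec\gamma\times\vec\gamma')\,ds-\tfrac16\vec\gamma(t_0)\times(\vec b\times\vec\gamma(t_0))$ (volume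 vector). Both sides of each identity are evaluated on the same fundamental domain $I$. *)

(* Defs.v *)
From HB Require Import structures.
From mathcomp Require Import all_boot all_order all_algebra.
From mathcomp Require Import all_classical all_reals all_analysis.
Set Implicit Arguments.
Unset Strict Implicit.
Unset Printing Implicit Defensive.
Import Order.TTheory GRing.Theory Num.Theory.
Import numFieldNormedType.Exports.
Local Open Scope classical_set_scope.
Local Open Scope ring_scope.

Section Euclidean.
Variable R : realType.
Implicit Types u v : 'cV[R]_3.

Definition dotv u v : R := \sum_i u i 0 * v i 0.

(* The library norm on 'cV[R]_3 is the sup norm; lengths below use this one. *)
Definition enorm u : R := Num.sqrt (dotv u u).

(* Indices are added modulo 3. *)
Definition crossv u v : 'cV[R]_3 :=
  \col_(i < 3) (u (i + 1) 0 * v (i + 2) 0 - u (i + 2) 0 * v (i + 1) 0).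

Definition parallel u v : Prop := exists a : R, u = a *: v.

Definition perp_part s u : 'cV[R]_3 := u - dotv s u *: s.

(* Rodrigues' formula for the rotation by angle theta about the line p + R u,
   u a unit vector. *)
Definition axis_rotation (p u : 'cV[R]_3) (theta : R) (x : 'cV[R]_3) :
    'cV[R]_3 :=
  p + (cos theta *: (x - p) + sin theta *: crossv u (x - p)
       + ((1 - cos theta) * dotv u (x - p)) *: u).

End Euclidean.

Section RigidMotions.
Variable R : realType.

Definition SO3 : {pred 'M[R]_3} :=
  [pred Q : 'M[R]_3 | (Q^T *m Q == 1%:M) && (\det Q == 1)].

Record SE3 := MkSE3 {
  rotation : 'M[R]_3;
  translation : 'cV[R]_3;
  rotation_SO3 : rotation \in SO3 }.

Definition SE3_act (g : SE3) (x : 'cV[R]_3) : 'cV[R]_3 :=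
  rotation g *m x + translation g.

Lemma SO3_1 : 1%:M \in SO3.
Proof. by rewrite inE trmx1 mulmx1 det1 !eqxx. Qed.

Lemma SO3_mul (P Q : 'M[R]_3) : P \in SO3 -> Q \in SO3 -> P *m Q \in SO3.
Proof.
rewrite !inE => /andP[/eqP hP /eqP dP] /andP[/eqP hQ /eqP dQ].
rewrite trmx_mul -mulmxA (mulmxA P^T) hP mul1mx hQ eqxx /=.
by rewrite det_mulmx dP dQ mulr1.
Qed.

Definition SE3_id : SE3 := MkSE3 0 SO3_1.

Definition SE3_mul (g h : SE3) : SE3 :=
  MkSE3 (rotation g *m translation h + translation g)
        (SO3_mul (rotation_SO3 g) (rotation_SO3 h)).

Lemma SE3_actM (g h : SE3) : SE3_act (SE3_mul g h) = SE3_act g \o SE3_act h.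
Proof. by apply/funext => x; rewrite /SE3_act /= mulmxDr mulmxA addrA. Qed.

Definition centralizer (g : SE3) : set SE3 :=
  [set h | SE3_mul h g = SE3_mul g h].

Definition pure_half_turn (g : SE3) : Prop :=
  exists p u : 'cV[R]_3,
    enorm u = 1 /\ forall x, SE3_act g x = axis_rotation p u pi x.

(* For rotation g <> 1, the points that g displaces along its rotation axis;
   this set is then the screw axis, and contains the origin iff
   rotation g *m translation g = translation g. For rotation g = 1 it is the
   whole space. *)
Definition screw_axis (g : SE3) : set 'cV[R]_3 :=
  [set p | rotation g *m (SE3_act g p - p) = SE3_act g p - p].

Lemma screw_axis0 (g : SE3) :
  screw_axis g 0 <-> rotation g *m translation g = translation g.
Proof. by rewrite /screw_axis /= /SE3_act mulmx0 add0r subr0. Qed.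

End RigidMotions.

Section Curves.
Variable R : realType.
Variable T0 : R.
Implicit Types (gamma : R -> 'cV[R]_3) (g : SE3 R).

Definition tau (t : R) : R := t + T0.

Definition smooth gamma : Prop :=
  forall (n : nat) (t : R), derivable (derive1n n gamma) t 1.

Definition smooth_immersion gamma : Prop :=
  smooth gamma /\ forall t, derive1 gamma t != 0.

Definition Mg g : set (R -> 'cV[R]_3) :=
  [set gamma | smooth_immersion gamma /\
               forall t, gamma (tau t) = SE3_act g (gamma t)].

Definition speed gamma (t : R) : R := enorm (derive1 gamma t).

Definition arc_derive gamma (t : R) : 'cV[R]_3 :=
  (speed gamma t)^-1 *: derive1 gamma t.

(* Componentwise integral of F ds, with ds = speed gamma t dt, over the
   fundamental domain [t0, tau t0]. *)
Definition arc_integral gamma (t0 : R) (F : R -> 'cV[R]_3) : 'cV[R]_3 :=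
  \col_(i < 3) \int[@lebesgue_measure R]_(t in `[t0, tau t0])
                 (speed gamma t * F t i 0).

Definition area_vector g (t0 : R) gamma : 'cV[R]_3 :=
  2^-1 *: arc_integral gamma t0
            (fun t => crossv (gamma t) (arc_derive gamma t))
  - 2^-1 *: crossv (translation g) (gamma t0).

Definition volume_vector g (t0 : R) gamma : 'cV[R]_3 :=
  3^-1 *: arc_integral gamma t0
            (fun t => crossv (gamma t)
                        (crossv (gamma t) (arc_derive gamma t)))
  - 6^-1 *: crossv (gamma t0) (crossv (translation g) (gamma t0)).

End Curves.

(* Main.v *)
Require Import Defs.
From HB Require Import structures.
From mathcomp Require Import all_boot all_order all_algebra.
From mathcomp Require Import all_classical all_reals all_analysis.
From mathcomp Require Import ring lra.
Import Order.TTheory GRing.Theory Num.Theory.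
Import numFieldNormedType.Exports.
Local Open Scope classical_set_scope.
Local Open Scope ring_scope.
Set Implicit Arguments.
Unset Strict Implicit.

(** Write [*] for the cross product and a prime for the derivative in the
    parameter of the curve. The arc length integrals are integrals of
    [gamma * gamma'] and [gamma * (gamma * gamma')], because the speed cancels
    between [ds] and the unit tangent. For [h = (Q, c)] put [y = Q gamma], so
    that [h o gamma = y + c], and expand. As [Q] commutes with the cross
    product, the terms without [c] give [Q A] and [Q V]. The term of the area
    integrand with [c] is the derivative of [c * y]. In the volume integrand the
    term quadratic in [c] is the derivative of [c * (c * y)], and the terms
    linear in [c] are [y * (c * y') + c * (y * y')]; by the Jacobi identity
      [2 y * (c * y') = c * (y * y') + (y * (c * y))'],
    so they give [c * Q A] and another derivative. By the fundamental theorem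
    of calculus the defects are therefore explicit vectors in the end points,
    for any [h] and any curve ([area_vector_act], [volume_vector_act]); the
    boundary corrections in the area and volume vectors contribute the rest.

    It remains to insert [gamma (tau t0) = R gamma t0 + b] and the condition
    that [h] commutes with [g]. If [g = 1], the end points agree and all defects
    vanish. If [R = 1] and [b <> 0], commuting means [Q b = b] and the defects
    are polynomials in [b], [c] and one end point; the end point cancels
    ([volume_defect_translation]). If [R <> 1], then [c] and [b] are multiples
    of the axis [s]; the area defect is then orthogonal to [s], and the axial
    component of the volume defect is proportional to the change of the squared
    distance to the axis, which a screw motion preserves ([volume_defect_screw]).

    That [h] is a screw motion about the same axis is the only place where
    half-turns matter ([centralizer_screw_motion]). [Q] maps the fixed line of
    [R] to itself, so [Q s = s] or [Q s = - s]. The vector representing the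
    antisymmetric part of [R] is fixed by both [R] and [Q]; if [Q s = - s] it
    vanishes, so [R] is a symmetric rotation, which makes it the half-turn
    about [s], and the axial translation [b] vanishes as well. *)

(** * Coordinates in three-space *)

Section Coordinates.
Variable R : realType.
Implicit Types (b s u v w x y z : 'cV[R]_3) (M Q : 'M[R]_3).

Lemma ord3_cases (P : 'I_3 -> Prop) : P 0 -> P 1 -> P 2 -> forall i, P i.
Proof.
by move=> P0 P1 P2 [[|[|[|//]]] hi];
  [move: P0|move: P1|move: P2]; congr P; exact: val_inj.
Qed.

Lemma sum_ord3 (V : nmodType) (F : 'I_3 -> V) : \sum_i F i = F 0 + F 1 + F 2.
Proof.
rewrite !big_ord_recr big_ord0 /= add0r.
by congr (F _ + F _ + F _); exact: val_inj.
Qed.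

Lemma cV3P u v : u 0 0 = v 0 0 -> u 1 0 = v 1 0 -> u 2 0 = v 2 0 -> u = v.
Proof.
by move=> h0 h1 h2; apply/colP; exact: ord3_cases.
Qed.

Lemma crossv0 u v : crossv u v 0 0 = u 1 0 * v 2 0 - u 2 0 * v 1 0.
Proof. by rewrite mxE !add0r. Qed.

Lemma crossv1 u v : crossv u v 1 0 = u 2 0 * v 0 0 - u 0 0 * v 2 0.
Proof.
by rewrite mxE; congr (u _ 0 * v _ 0 - u _ 0 * v _ 0); exact: val_inj.
Qed.

Lemma crossv2 u v : crossv u v 2 0 = u 0 0 * v 1 0 - u 1 0 * v 0 0.
Proof.
by rewrite mxE; congr (u _ 0 * v _ 0 - u _ 0 * v _ 0); exact: val_inj.
Qed.

Lemma addvE u v i : (u + v) i 0 = u i 0 + v i 0. Proof. by rewrite mxE. Qed.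
Lemma oppvE u i : (- u) i 0 = - u i 0. Proof. by rewrite mxE. Qed.
Lemma scalevE a u i : (a *: u) i 0 = a * u i 0. Proof. by rewrite mxE. Qed.
Lemma zerovE i : (0 : 'cV[R]_3) i 0 = 0. Proof. by rewrite mxE. Qed.
Lemma mulmxvE M u i :
  (M *m u) i 0 = M i 0 * u 0 0 + M i 1 * u 1 0 + M i 2 * u 2 0.
Proof. by rewrite mxE sum_ord3. Qed.

Lemma dotvE u v : dotv u v = u 0 0 * v 0 0 + u 1 0 * v 1 0 + u 2 0 * v 2 0.
Proof. exact: sum_ord3. Qed.

Definition coordE :=
  (crossv0, crossv1, crossv2, addvE, oppvE, scalevE, zerovE, mulmxvE).

End Coordinates.

Ltac vec_ring := apply: cV3P; rewrite ?dotvE !coordE; ring.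

Section VectorIdentities.
Variable R : realType.
Implicit Types (b s u v w x y z : 'cV[R]_3) (M : 'M[R]_3).

Lemma det3E M : \det M = M 0 0 * (M 1 1 * M 2 2 - M 1 2 * M 2 1)
  - M 0 1 * (M 1 0 * M 2 2 - M 1 2 * M 2 0)
  + M 0 2 * (M 1 0 * M 2 1 - M 1 1 * M 2 0).
Proof.
rewrite (expand_det_row _ 0) sum_ord3 /cofactor.
rewrite !(expand_det_row _ (0 : 'I_2)) !big_ord_recl !big_ord0 /cofactor.
rewrite !det_mx11 !mxE.
(* Indexing the entries by natural numbers lets the index shifts of the
   cofactors compute. *)
pose N (m n : nat) := M (inord m) (inord n).
have E i j : M i j = N i j by rewrite /N !inord_val.
rewrite !E /= /bump /= ?modn_small//=.
ring.
Qed.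

Lemma dotvC u v : dotv u v = dotv v u.
Proof. by rewrite !dotvE; ring. Qed.
Lemma dotvDr u v w : dotv u (v + w) = dotv u v + dotv u w.
Proof. by rewrite !dotvE !coordE; ring. Qed.
Lemma dotvZr a u v : dotv u (a *: v) = a * dotv u v.
Proof. by rewrite !dotvE !coordE; ring. Qed.

Lemma dotv_crossv_crossv s x y z :
  dotv s (crossv x (crossv y z)) = dotv s y * dotv x z - dotv s z * dotv x y.
Proof. by rewrite !dotvE !coordE; ring. Qed.

Lemma dotvDl u v w : dotv (u + v) w = dotv u w + dotv v w.
Proof. by rewrite dotvC dotvDr !(dotvC w). Qed.
Lemma dotvZl a u v : dotv (a *: u) v = a * dotv u v.
Proof. by rewrite dotvC dotvZr dotvC. Qed.
Lemma dotvNr u v : dotv u (- v) = - dotv u v.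
Proof. by rewrite !dotvE !coordE; ring. Qed.
Lemma dotvNl u v : dotv (- u) v = - dotv u v.
Proof. by rewrite !dotvE !coordE; ring. Qed.

Definition dotE :=
  (dotv_crossv_crossv, dotvDl, dotvDr, dotvZl, dotvZr, dotvNl, dotvNr).

Lemma crossvZr a u v : crossv u (a *: v) = a *: crossv u v.
Proof. vec_ring. Qed.

Lemma dotvv_eq0 u : dotv u u = 0 -> u = 0.
Proof.
move=> /eqP; rewrite dotvE !paddr_eq0 ?addr_ge0 -?expr2 ?sqr_ge0//.
by rewrite !sqrf_eq0 => /andP[/andP[/eqP ? /eqP ?] /eqP ?];
  apply: cV3P; rewrite zerovE.
Qed.

Lemma dotvv_ge0 u : 0 <= dotv u u.
Proof. by rewrite dotvE !addr_ge0 -?expr2 ?sqr_ge0. Qed.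

Lemma enorm_sqr u : enorm u ^+ 2 = dotv u u.
Proof. by rewrite sqr_sqrtr// dotvv_ge0. Qed.

Lemma enorm_eq0 u : enorm u = 0 -> u = 0.
Proof. by move=> u0; apply: dotvv_eq0; rewrite -enorm_sqr u0 expr0n. Qed.

Lemma enorm1_dotv s : enorm s = 1 -> dotv s s = 1.
Proof. by rewrite -enorm_sqr => ->; rewrite expr1n. Qed.

Lemma enorm_normalize b : b <> 0 ->
  let s := (enorm b)^-1 *: b in dotv s s = 1 /\ b = enorm b *: s.
Proof.
move=> b0 s; have nb0 : enorm b != 0 by apply/eqP => /enorm_eq0.
rewrite /s dotvZl dotvZr -enorm_sqr scalerA divff// scale1r; split=> //.
by field.
Qed.

Lemma crossv_eq0_parallel s v :
  dotv s s = 1 -> crossv s v = 0 -> v = dotv s v *: s.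
Proof.
move=> s1 sv0.
have : dotv s s *: v = dotv s v *: s - crossv s (crossv s v) by vec_ring.
by rewrite s1 scale1r sv0 => {1}->; vec_ring.
Qed.

End VectorIdentities.

(** * Rotations *)

Section Rotations.
Variable R : realType.
Implicit Types (s u v w x y : 'cV[R]_3) (M Q : 'M[R]_3).

Lemma SO3_trmxK Q : Q \in @SO3 R -> Q^T *m Q = 1%:M.
Proof. by rewrite inE => /andP[/eqP]. Qed.

Lemma SO3_mul_trmx Q : Q \in @SO3 R -> Q *m Q^T = 1%:M.
Proof. by move/SO3_trmxK/mulmx1C. Qed.

Lemma dotv_trmx M u v : dotv (M *m u) v = dotv u (M^T *m v).
Proof. by rewrite !dotvE !coordE !mxE; ring. Qed.

Lemma SO3_dotv Q u v : Q \in @SO3 R -> dotv (Q *m u) (Q *m v) = dotv u v.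
Proof. by move=> hQ; rewrite dotv_trmx mulmxA SO3_trmxK// mul1mx. Qed.

(** Cofactor formula for an arbitrary matrix; for a rotation it says that the
    cross product is equivariant. *)
Lemma trmx_mul_crossv M u v :
  M^T *m crossv (M *m u) (M *m v) = \det M *: crossv u v.
Proof. by rewrite det3E; apply: cV3P; rewrite !coordE !mxE; ring. Qed.

Lemma SO3_crossv Q u v :
  Q \in @SO3 R -> crossv (Q *m u) (Q *m v) = Q *m crossv u v.
Proof.
move=> hQ; have := trmx_mul_crossv Q u v.
have /andP[_ /eqP ->] := hQ; rewrite scale1r => <-.
by rewrite mulmxA SO3_mul_trmx// mul1mx.
Qed.

Lemma SO3_dotv_fixed Q s v :
  Q \in @SO3 R -> Q *m s = s -> dotv s (Q *m v) = dotv s v.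
Proof. by move=> hQ Qs; rewrite -{1}Qs SO3_dotv. Qed.

Lemma matrix_eq_action M Q : (forall x, M *m x = Q *m x) -> M = Q.
Proof.
move=> h; apply/matrixP => i j.
by have /matrixP/(_ i 0) := h (delta_mx j 0); rewrite -!colE !mxE.
Qed.

(** If [v] were not on the axis, [s], [v] and [crossv s v] would be a basis of
    fixed vectors. *)
Lemma SO3_fixed_parallel M s v : M \in @SO3 R -> M <> 1%:M -> dotv s s = 1 ->
  M *m s = s -> M *m v = v -> v = dotv s v *: s.
Proof.
move=> hM M1 s1 Ms Mv; apply: crossv_eq0_parallel => //.
set n := crossv s v; apply: contrapT => n0; apply: M1.
apply: matrix_eq_action => x; rewrite mul1mx.
have Mn : M *m n = n by rewrite -SO3_crossv// Ms Mv.
have nn0 : dotv n n != 0 by apply/eqP => /dotvv_eq0.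
(* Cramer's rule in the basis s, v, n, whose determinant is dotv n n. *)
have frame : dotv n n *: x = dotv x (crossv v n) *: s
    + dotv x (crossv n s) *: v + dotv x n *: n by rewrite /n; vec_ring.
apply: (scalerI nn0); rewrite scalemxAr frame.
by rewrite !mulmxDr -!scalemxAr Ms Mv Mn.
Qed.

(** The vector that represents the antisymmetric matrix [M - M^T] as a cross
    product; for a rotation by [theta] about the unit vector [s] it is
    [2 sin theta s]. *)
Definition axial M : 'cV[R]_3 :=
  \col_i (M (i + 2) (i + 1) - M (i + 1) (i + 2)).

Lemma crossv_axial M x : crossv (axial M) x = M *m x - M^T *m x.
Proof.
have a0 : axial M 0 0 = M 2 1 - M 1 2 by rewrite mxE !add0r.
have a1 : axial M 1 0 = M 0 2 - M 2 0.
  by rewrite mxE; congr (M _ _ - M _ _); exact: val_inj.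
have a2 : axial M 2 0 = M 1 0 - M 0 1.
  by rewrite mxE; congr (M _ _ - M _ _); exact: val_inj.
by apply: cV3P; rewrite !coordE ?a0 ?a1 ?a2 !mxE; ring.
Qed.

Lemma crossv_injl u v : (forall x, crossv u x = crossv v x) -> u = v.
Proof.
move=> h; apply/eqP; rewrite -subr_eq0; apply/eqP/dotvv_eq0.
have d0 x : crossv (u - v) x = 0.
  by apply: etrans (subrr (crossv v x)); rewrite -{1}h; vec_ring.
(* Crossing with the basis vectors detects the coordinates of u - v. *)
have := congr1 (fun w : 'cV[R]_3 => w 2 0) (d0 (delta_mx 1 0)).
have := congr1 (fun w : 'cV[R]_3 => w 0 0) (d0 (delta_mx 2 0)).
have := congr1 (fun w : 'cV[R]_3 => w 1 0) (d0 (delta_mx 0 0)).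
rewrite !coordE !mxE/= !mulr1 !mulr0 !subr0 dotvE !coordE.
by move=> -> -> ->; ring.
Qed.

(** [Q] also commutes with [M - M^T], and it transports the cross product. *)
Lemma axial_comm M Q :
  Q \in @SO3 R -> Q *m M = M *m Q -> Q *m axial M = axial M.
Proof.
move=> hQ QM; apply: crossv_injl => x.
have QMT : Q *m M^T = M^T *m Q.
  rewrite -[LHS]mulmx1 -(SO3_trmxK hQ) -!mulmxA [M^T *m _]mulmxA.
  by rewrite -trmx_mul QM trmx_mul !mulmxA SO3_mul_trmx// mul1mx.
have -> : x = Q *m (Q^T *m x) by rewrite mulmxA SO3_mul_trmx// mul1mx.
rewrite SO3_crossv// !crossv_axial mulmxBr.
by rewrite [Q *m (M *m _)]mulmxA [Q *m (M^T *m _)]mulmxA QM QMT -!mulmxA.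
Qed.

(** A rotation commuting with [M] preserves the axis of [M]. It can reverse it
    only if [M] is a half-turn: the axial vector of [M] lies on the axis and is
    fixed by [Q], so it vanishes and [M] is an involution. *)
Lemma commuting_SO3_axis M Q s : M \in @SO3 R -> Q \in @SO3 R ->
    Q *m M = M *m Q -> M <> 1%:M -> dotv s s = 1 -> M *m s = s ->
  Q *m s = s \/
  Q *m s = - s /\ forall x, M *m x = - x + (2 * dotv s x) *: s.
Proof.
move=> hM hQ QM M1 s1 Ms.
have fixP := SO3_fixed_parallel hM M1 s1 Ms.
have Qs : Q *m s = dotv s (Q *m s) *: s.
  by apply: fixP; rewrite mulmxA -QM -mulmxA Ms.
have : dotv s (Q *m s) ^+ 2 = 1.
  have := SO3_dotv s s hQ; rewrite s1 Qs; set k := dotv s _.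
  by rewrite dotvZr dotvC dotvZr s1 mulr1.
move=> /eqP; rewrite sqrf_eq1 => /orP[/eqP e|/eqP e].
  by left; rewrite Qs e scale1r.
right; rewrite Qs e scaleN1r; split=> // x.
have r0 : axial M = 0.
  have rs := fixP _ (axial_comm hM (erefl (M *m M))).
  have := axial_comm hQ QM.
  rewrite rs -scalemxAr Qs e scaleN1r scalerN => /eqP.
  rewrite eq_sym -addr_eq0 -mulr2n -scaler_nat scaler_eq0 pnatr_eq0.
  by move=> /eqP ->.
have MMT (y : 'cV[R]_3) : M *m y = M^T *m y.
  by apply: subr0_eq; rewrite -crossv_axial r0; vec_ring.
(* M is an involution, so x + M x is fixed by M. *)
have : x + M *m x = dotv s (x + M *m x) *: s.
  by apply: fixP; rewrite mulmxDr [M *m (M *m x)]MMT mulmxA SO3_trmxK//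
    mul1mx addrC.
rewrite dotvDr SO3_dotv_fixed// mulr_natl mulr2n => <-.
by rewrite addrA addNr add0r.
Qed.

End Rotations.

(** * Centralizers of screw motions *)

Section Centralizer.
Variable R : realType.
Implicit Types (g h k l : SE3 R) (s : 'cV[R]_3).

Lemma SE3_ext k l :
  rotation k = rotation l -> translation k = translation l -> k = l.
Proof.
case: k l => [P p hP] [Q q hQ] /= e1 e2; subst.
by congr MkSE3; exact: bool_irrelevance.
Qed.

Lemma centralizerP g k : centralizer g k <->
  rotation k *m rotation g = rotation g *m rotation k /\
  rotation k *m translation g + translation k =
  rotation g *m translation k + translation g.
Proof.
split=> [e|[e1 e2]]; last exact: SE3_ext.
by split; [have := congr1 (@rotation R) e | have := congr1 (@translation R) e].
Qed.

(** If [h] reversed the axis, [g] would be a half-turn by [commuting_SO3_axis];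
    comparing the axial components of [Q b + c = R c + b] then gives [b = 0]. *)
Lemma centralizer_screw_motion g h s :
  ~ pure_half_turn g -> rotation g <> 1%:M ->
  rotation g *m translation g = translation g ->
  dotv s s = 1 -> rotation g *m s = s -> centralizer g h ->
  [/\ translation g = dotv s (translation g) *: s,
      rotation h *m s = s &
      translation h = dotv s (translation h) *: s].
Proof.
move=> nturn R1 Rb s1 Rs /centralizerP[QR eb].
have hR := rotation_SO3 g; have hQ := rotation_SO3 h.
have fixP := SO3_fixed_parallel hR R1 s1 Rs.
have bs := fixP _ Rb.
have [Qs|[Qs Rhalf]] := commuting_SO3_axis hR hQ QR R1 s1 Rs.
  split=> //; apply: fixP; move: eb.
  by rewrite bs -scalemxAr Qs addrC => /addIr.
case: nturn; exists 0, s; split.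
  by rewrite /enorm s1 sqrtr1.
have b0 : translation g = 0.
  have sQb : dotv s (rotation h *m translation g) = - dotv s (translation g).
    by rewrite -[in LHS](opprK s) -Qs dotvNl SO3_dotv.
  have := congr1 (dotv s) eb; rewrite !dotvDr sQb.
  rewrite (SO3_dotv_fixed _ hR Rs) => sb.
  by rewrite bs (_ : dotv s _ = 0) ?scale0r//; lra.
move=> x; rewrite /SE3_act b0 addr0 Rhalf /axis_rotation cospi sinpi subr0.
by rewrite !add0r scaleN1r scale0r addr0 opprK; congr (_ + _ *: _).
Qed.

End Centralizer.

(** * Vector calculus on a segment *)

Section VectorCalculus.
Variable R : realType.
Implicit Types (F G H : R -> 'cV[R]_3) (c : 'cV[R]_3) (Q : 'M[R]_3).

(** Derivatives and continuity are taken coordinatewise, because integrals of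
    vector functions are. *)
Definition coord_derive F H : Prop :=
  forall t i, is_derive t (1 : R) (fun x => F x i 0) (H t i 0).

Definition coords_continuous F : Prop :=
  forall i, continuous (fun t => F t i 0).

Lemma coord_derive_continuous F H : coord_derive F H -> coords_continuous F.
Proof.
move=> dF i t; apply/differentiable_continuous/derivable1_diffP.
by case: (dF t i).
Qed.

Lemma coord_derive_derive1 F H :
  coord_derive F H -> forall t, derive1 F t = H t.
Proof.
move=> dF t; rewrite derive1E derive_mx.
  by apply/matrixP => i j; rewrite mxE ord1; case: (dF t i).
by apply/derivable_mxP => i j; rewrite ord1; case: (dF t i).
Qed.

Lemma derive1_coord_derive F :
  (forall t, derivable F t (1 : R)) -> coord_derive F (derive1 F).
Proof.
move=> dF t i; rewrite derive1E derive_mx// mxE.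
by apply: derivableP; move/derivable_mxP: (dF t) => /(_ i 0).
Qed.

Lemma coord_derive_cst c : coord_derive (fun=> c) (fun=> 0).
Proof. by move=> t i; rewrite mxE; exact: is_derive_cst. Qed.

Lemma coord_deriveD F G F' G' : coord_derive F F' -> coord_derive G G' ->
  coord_derive (fun t => F t + G t) (fun t => F' t + G' t).
Proof.
move=> dF dG t i; rewrite addvE.
rewrite [X in is_derive _ _ X _](_ : _ =
    (fun x => F x i 0) + (fun x => G x i 0)).
  exact: is_deriveD.
by apply/funext => x; rewrite addvE.
Qed.

Lemma coord_deriveZ (a : R) F F' : coord_derive F F' ->
  coord_derive (fun t => a *: F t) (fun t => a *: F' t).
Proof.
move=> dF t i; rewrite scalevE.
rewrite [X in is_derive _ _ X _](_ : _ = a \*: (fun x => F x i 0)).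
  exact: is_deriveZ.
by apply/funext => x; rewrite scalevE.
Qed.

Lemma coord_derive_mulmx Q F F' : coord_derive F F' ->
  coord_derive (fun t => Q *m F t) (fun t => Q *m F' t).
Proof.
move=> dF t i; rewrite mxE.
rewrite [X in is_derive _ _ X _](_ : _ =
    \sum_(k < 3) (Q i k \*: (fun x => F x k 0))).
  by apply: is_derive_sum => k; exact: is_deriveZ.
by apply/funext => x; rewrite mxE fct_sumE.
Qed.

Lemma coord_derive_crossv F G F' G' : coord_derive F F' -> coord_derive G G' ->
  coord_derive (fun t => crossv (F t) (G t))
    (fun t => crossv (F' t) (G t) + crossv (F t) (G' t)).
Proof.
move=> dF dG t i; rewrite !mxE.
rewrite [X in is_derive _ _ X _](_ : _ =
  (fun x => F x (i + 1) 0) * (fun x => G x (i + 2) 0)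
  - (fun x => F x (i + 2) 0) * (fun x => G x (i + 1) 0)); last first.
  by apply/funext => x; rewrite mxE.
have dF1 := dF t (i + 1); have dF2 := dF t (i + 2).
have dG1 := dG t (i + 1); have dG2 := dG t (i + 2).
by apply: is_derive_eq; rewrite /GRing.scale /=; ring.
Qed.

(** The matrix of [crossv c], so that the rules for matrix products apply to
    cross products with a fixed vector. *)
Definition crossv_mx c : 'M[R]_3 := \matrix_(i, j) crossv c (delta_mx j 0) i 0.

Lemma mul_crossv_mx c (v : 'cV[R]_3) : crossv_mx c *m v = crossv c v.
Proof.
have mE i j : crossv_mx c i j = crossv c (delta_mx j 0) i 0 by rewrite mxE.
by apply: cV3P; rewrite !coordE !mE !coordE !mxE /=; ring.
Qed.

Lemma coord_derive_crossvr c F F' : coord_derive F F' ->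
  coord_derive (fun t => crossv c (F t)) (fun t => crossv c (F' t)).
Proof.
move=> dF; have := coord_derive_mulmx (crossv_mx c) dF.
under eq_fun do rewrite mul_crossv_mx.
by under [X in coord_derive _ X]eq_fun do rewrite mul_crossv_mx.
Qed.

Definition segment_integral (a b : R) F : 'cV[R]_3 :=
  \col_(i < 3) \int[@lebesgue_measure R]_(t in `[a, b]) F t i 0.

Lemma eq_segment_integral a b F G :
  F =1 G -> segment_integral a b F = segment_integral a b G.
Proof. by move=> /funext ->. Qed.

Let integrable_coord a b F i : coords_continuous F ->
  (@lebesgue_measure R).-integrable `[a, b] (EFin \o (fun t => F t i 0)).
Proof.
move=> cF; apply: continuous_compact_integrable; first exact: segment_compact.
exact: continuous_subspaceT.
Qed.

Lemma segment_integralD a b F G : coords_continuous F -> coords_continuous G ->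
  segment_integral a b (fun t => F t + G t) =
  segment_integral a b F + segment_integral a b G.
Proof.
move=> cF cG; apply/colP => i; rewrite !mxE.
rewrite -RintegralD//; [|exact: integrable_coord..].
by apply: eq_Rintegral => t _; rewrite mxE.
Qed.

Lemma segment_integralZ a b (k : R) F : coords_continuous F ->
  segment_integral a b (fun t => k *: F t) = k *: segment_integral a b F.
Proof.
move=> cF; apply/colP => i; rewrite !mxE.
rewrite -RintegralZl//; last exact: integrable_coord.
by apply: eq_Rintegral => t _; rewrite mxE.
Qed.

Lemma segment_integral_mulmx a b Q F : coords_continuous F ->
  segment_integral a b (fun t => Q *m F t) = Q *m segment_integral a b F.
Proof.
move=> cF; apply/colP => i; rewrite mulmxvE !mxE.
rewrite -!RintegralZl//; [|exact: integrable_coord..].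
have iZ k : (@lebesgue_measure R).-integrable `[a, b]
    (EFin \o (fun t => Q i k * F t k 0)).
  rewrite (_ : EFin \o _ = (fun t => (Q i k)%:E * (F t k 0)%:E)%E)//.
  by apply: (integrableZl _ (Q i k) (integrable_coord a b k cF)).
rewrite -!RintegralD//.
  by apply: eq_Rintegral => t _; rewrite mulmxvE.
by apply: (integrableD _ (iZ 0) (iZ 1)).
Qed.

Lemma segment_integral_crossvr a b c F : coords_continuous F ->
  segment_integral a b (fun t => crossv c (F t)) =
  crossv c (segment_integral a b F).
Proof.
move=> cF; rewrite -mul_crossv_mx -segment_integral_mulmx//.
by apply: eq_segment_integral => t; rewrite mul_crossv_mx.
Qed.

Lemma segment_integral_FTC a b F H : a < b -> coord_derive F H ->
  coords_continuous H -> segment_integral a b H = F b - F a.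
Proof.
move=> ab dF cH; have cF := coord_derive_continuous dF.
apply/colP => i; rewrite !mxE /Rintegral.
rewrite (@continuous_FTC2 _ _ (fun t => F t i 0))//.
- exact: continuous_subspaceT.
- split; first by move=> t _; case: (dF t i).
  + by apply: cvg_at_right_filter; exact: cF.
  + by apply: cvg_at_left_filter; exact: cF.
- by move=> t _; rewrite derive1E; case: (dF t i).
Qed.

End VectorCalculus.

(** * Area and volume vectors of a moved curve *)

Section MovedCurve.
Variable R : realType.
Implicit Types (c s x y : 'cV[R]_3).
Variables T0 t0 : R.
Hypothesis T0_gt0 : 0 < T0.
Implicit Types (g h : SE3 R) (F : R -> 'cV[R]_3).

(** The speed cancels between the arc length measure and the unit tangent. *)
Lemma area_vectorE g F F' : coord_derive F F' -> (forall t, F' t != 0) ->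
  area_vector T0 g t0 F =
  2^-1 *: segment_integral t0 (tau T0 t0) (fun t => crossv (F t) (F' t))
  - 2^-1 *: crossv (translation g) (F t0).
Proof.
move=> /coord_derive_derive1 dF F'0; rewrite /area_vector; congr (_ *: _ - _).
apply/colP => i; rewrite !mxE; apply: eq_Rintegral => t _.
rewrite /arc_derive /speed dF crossvZr scalevE mulrA divff ?mul1r//.
by apply/eqP => /enorm_eq0/eqP; exact/negP.
Qed.

Lemma volume_vectorE g F F' : coord_derive F F' -> (forall t, F' t != 0) ->
  volume_vector T0 g t0 F =
  3^-1 *: segment_integral t0 (tau T0 t0)
            (fun t => crossv (F t) (crossv (F t) (F' t)))
  - 6^-1 *: crossv (F t0) (crossv (translation g) (F t0)).
Proof.
move=> /coord_derive_derive1 dF F'0; rewrite /volume_vector; congr (_ *: _ - _).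
apply/colP => i; rewrite !mxE; apply: eq_Rintegral => t _.
rewrite /arc_derive /speed dF !crossvZr scalevE mulrA divff ?mul1r//.
by apply/eqP => /enorm_eq0/eqP; exact/negP.
Qed.

(** The part of the volume integral of [x + c] that depends on [c] and
    integrates to a boundary term. *)
Definition volume_primitive c x : 'cV[R]_3 :=
  6^-1 *: crossv x (crossv c x) + 3^-1 *: crossv c (crossv c x).

Section RigidMotion.
Variables (F F' F'' : R -> 'cV[R]_3).
Hypotheses (dF : coord_derive F F') (dF' : coord_derive F' F'').
Hypothesis F'_neq0 : forall t, F' t != 0.
Variables (g h : SE3 R).
Let Q := rotation h.
Let c := translation h.
Let b := translation g.
Let x0 := F t0.
Let x1 := F (tau T0 t0).

Let hF : coord_derive (SE3_act h \o F) (fun t => Q *m F' t).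
Proof.
have := coord_deriveD (coord_derive_mulmx Q dF) (coord_derive_cst c).
by under [X in coord_derive _ X]eq_fun do rewrite addr0.
Qed.

Let hF_neq0 t : Q *m F' t != 0.
Proof.
apply: contra (F'_neq0 t) => /eqP QF0; apply/eqP.
rewrite -[F' t]mul1mx -(SO3_trmxK (rotation_SO3 h)) -mulmxA.
by rewrite [X in _ *m X]QF0 mulmx0.
Qed.

Let hQ : Q \in @SO3 R := rotation_SO3 h.

Let tau_gt : t0 < tau T0 t0. Proof. by rewrite ltrDl. Qed.

(** With [*] the cross product, the integrand for [h o F] is [Q (F * F')] plus
    the derivative of [c * Q F]. *)
Lemma area_vector_act :
  area_vector T0 g t0 (SE3_act h \o F) = Q *m area_vector T0 g t0 F
    + 2^-1 *: (crossv c (Q *m (x1 - x0)) - crossv b (Q *m x0 + c)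
               + crossv (Q *m b) (Q *m x0)).
Proof.
rewrite (area_vectorE _ hF hF_neq0) (area_vectorE _ dF F'_neq0).
rewrite [segment_integral _ _ (fun t => crossv ((_ \o _) t) _)](_ : _ =
  Q *m segment_integral t0 (tau T0 t0) (fun t => crossv (F t) (F' t))
  + crossv c (Q *m (x1 - x0))).
  rewrite !mulmxBr -!scalemxAr -SO3_crossv// -/b /= /SE3_act -/Q -/c -/x0.
  move: (Q *m segment_integral _ _ _) (Q *m x1) (Q *m b) (Q *m x0).
  by move=> u v w x; vec_ring.
have d1 := coord_derive_mulmx Q (coord_derive_crossv dF dF').
have d2 := coord_derive_crossvr c (coord_derive_mulmx Q dF').
have c2 := coord_derive_continuous (coord_derive_mulmx Q dF').
rewrite -(segment_integral_FTC tau_gt dF (coord_derive_continuous dF')).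
rewrite -segment_integral_mulmx; last first.
  exact: coord_derive_continuous (coord_derive_crossv dF dF').
rewrite -segment_integral_mulmx; last exact: coord_derive_continuous dF'.
rewrite -segment_integral_crossvr//.
rewrite -segment_integralD; last 2 first.
- exact: coord_derive_continuous d1.
- exact: coord_derive_continuous d2.
apply: eq_segment_integral => t; rewrite /= /SE3_act -/Q -/c -SO3_crossv//.
move: (Q *m _) (Q *m _) => u v; vec_ring.
Qed.

(* The derivative of volume_primitive c (Q F); it is differentiable in turn,
   which gives the continuity needed to integrate it. *)
Let P' t :=
  6^-1 *: (crossv (Q *m F' t) (crossv c (Q *m F t))
           + crossv (Q *m F t) (crossv c (Q *m F' t)))
  + 3^-1 *: crossv c (crossv c (Q *m F' t)).

Let dP : coord_derive (fun t => volume_primitive c (Q *m F t)) P'.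
Proof.
have dx := coord_derive_mulmx Q dF; have dcx := coord_derive_crossvr c dx.
exact: (coord_deriveD (coord_deriveZ _ (coord_derive_crossv dx dcx))
  (coord_deriveZ _ (coord_derive_crossvr c dcx))).
Qed.

Let dP' : exists P'', coord_derive P' P''.
Proof.
have dx := coord_derive_mulmx Q dF; have dcx := coord_derive_crossvr c dx.
have dy := coord_derive_mulmx Q dF'; have dcy := coord_derive_crossvr c dy.
eexists; exact: (coord_deriveD
  (coord_deriveZ _ (coord_deriveD (coord_derive_crossv dy dcx)
                                  (coord_derive_crossv dx dcy)))
  (coord_deriveZ _ (coord_derive_crossvr c dcy))).
Qed.

(** With [*] the cross product, the integrand for [h o F] is
    [Q (F * (F * F')) + (3/2) c * Q (F * F')] plus three times the derivative of
    [volume_primitive c (Q F)], by the Jacobi identity. *)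
Lemma volume_vector_act :
  volume_vector T0 g t0 (SE3_act h \o F) =
  Q *m volume_vector T0 g t0 F + crossv c (Q *m area_vector T0 g t0 F)
  + (volume_primitive c (Q *m x1) - volume_primitive c (Q *m x0)
     - 6^-1 *: crossv (Q *m x0 + c) (crossv b (Q *m x0 + c))
     + 6^-1 *: crossv (Q *m x0) (crossv (Q *m b) (Q *m x0))
     + 2^-1 *: crossv c (crossv (Q *m b) (Q *m x0))).
Proof.
rewrite (volume_vectorE _ hF hF_neq0) (volume_vectorE _ dF F'_neq0).
rewrite (area_vectorE _ dF F'_neq0).
set I2 := segment_integral _ _ (fun t => crossv (F t) (F' t)).
set I3 := segment_integral _ _ (fun t => crossv (F t) (crossv _ _)).
rewrite [segment_integral _ _ (fun t => crossv ((_ \o _) t) _)](_ : _ =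
  Q *m I3 + (3 * 2^-1) *: crossv c (Q *m I2)
  + 3 *: (volume_primitive c (Q *m x1) - volume_primitive c (Q *m x0))).
  rewrite !mulmxBr -!scalemxAr -!SO3_crossv// -/b /= /SE3_act -/Q -/c -/x0.
  move: (volume_primitive _ _) (volume_primitive _ _) => p1 p0.
  move: (Q *m I3) (Q *m I2) (Q *m b) (Q *m x0) => u v w x.
  by apply: cV3P; rewrite !coordE; field.
have d2 := coord_derive_crossv dF dF'; have d3 := coord_derive_crossv dF d2.
have dQ2 := coord_derive_crossvr c (coord_derive_mulmx Q d2).
have dQ3 := coord_derive_mulmx Q d3.
have dZ2 := coord_deriveZ (3 * 2^-1) dQ2.
have [P'' dP2] := dP'; have cP := coord_derive_continuous dP2.
have cZ := coord_derive_continuous (coord_deriveZ 3 dP2).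
rewrite -(segment_integral_FTC tau_gt dP cP) -segment_integralZ//.
rewrite -segment_integral_mulmx; last exact: coord_derive_continuous d3.
rewrite -segment_integral_mulmx; last exact: coord_derive_continuous d2.
rewrite -segment_integral_crossvr; last first.
  exact: coord_derive_continuous (coord_derive_mulmx Q d2).
rewrite -segment_integralZ; last exact: coord_derive_continuous dQ2.
rewrite -segment_integralD; last 2 first.
- exact: coord_derive_continuous dQ3.
- exact: coord_derive_continuous dZ2.
rewrite -segment_integralD; last 2 first.
- exact: coord_derive_continuous (coord_deriveD dQ3 dZ2).
- exact: cZ.
apply: eq_segment_integral => t; rewrite /P' /= /SE3_act -/Q -/c -!SO3_crossv//.
by move: (Q *m _) (Q *m _) => u v; apply: cV3P; rewrite !coordE; field.
Qed.

End RigidMotion.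

End MovedCurve.

(** * Axial components of the volume defect *)

Section VolumeDefect.
Variable R : realType.
Implicit Types (beta kappa : R) (c s x y : 'cV[R]_3).

(** The boundary terms of [volume_vector_act] when [R = 1] and [Q b = b], with
    [x] the rotated end point. The terms bilinear in the parts of [x] and [c]
    orthogonal to [s] have weights [-1/6], [-1/3] and [1/2] times [beta], so
    they cancel. *)
Lemma volume_defect_translation beta s c x : dotv s s = 1 ->
  let b := beta *: s in
  dotv s (volume_primitive c (x + b) - volume_primitive c x
     - 6^-1 *: crossv (x + c) (crossv b (x + c))
     + 6^-1 *: crossv x (crossv b x) + 2^-1 *: crossv c (crossv b x))
  = - (2^-1 * beta * enorm (perp_part s c) ^+ 2).
Proof.
move=> ss /=; rewrite enorm_sqr /volume_primitive /perp_part !dotE.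
by rewrite ss (dotvC x s) (dotvC c s) (dotvC x c); field.
Qed.

(** When [c] is axial, [dotv s (volume_primitive c x)] is a multiple of the
    squared distance from [x] to the axis, which is assumed equal at both end
    points, and the other terms do not see the axial shift [c] of [x]. *)
Lemma volume_defect_screw beta kappa s x y : dotv s s = 1 ->
  dotv y y - dotv s y ^+ 2 = dotv x x - dotv s x ^+ 2 ->
  let b := beta *: s in let c := kappa *: s in
  dotv s (volume_primitive c y - volume_primitive c x
     - 6^-1 *: crossv (x + c) (crossv b (x + c))
     + 6^-1 *: crossv x (crossv b x) + 2^-1 *: crossv c (crossv b x)) = 0.
Proof.
move=> ss e /=; rewrite /volume_primitive !dotE.
rewrite ss (dotvC x s) (dotvC y s).
have -> : dotv y y = dotv x x - dotv s x ^+ 2 + dotv s y ^+ 2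
  by rewrite -e; ring.
by field.
Qed.

End VolumeDefect.

(** * The transformation rules *)

Theorem theorem3p1 (R : realType) (T0 : R) (hT0 : 0 < T0)
    (g : SE3 R) (gamma : R -> 'cV[R]_3) (hgamma : Mg T0 g gamma)
    (hturn : ~ pure_half_turn g)
    (horigin : rotation g <> 1%:M -> screw_axis g 0)
    (h : SE3 R) (hh : centralizer g h) (t0 : R) :
  let b := translation g in
  let Q := rotation h in
  let c := translation h in
  let A := area_vector T0 g t0 in
  let V := volume_vector T0 g t0 in
  let hgam := SE3_act h \o gamma in
  (g = SE3_id R ->
     (forall k : SE3 R, centralizer g k) /\
     A hgam = Q *m A gamma /\
     V hgam = Q *m V gamma + crossv c (Q *m A gamma)) /\
  (rotation g = 1%:M -> b <> 0 ->
     let s := (enorm b)^-1 *: b in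
     (forall k : SE3 R, centralizer g k <-> rotation k *m s = s) /\
     A hgam = Q *m A gamma + crossv c b /\
     dotv s (V hgam) =
       dotv s (Q *m V gamma + crossv c (Q *m A gamma))
       - 2^-1 * enorm b * enorm (perp_part s c) ^+ 2 /\
     (parallel c s ->
        crossv c b = 0 /\
        - (2^-1 * enorm b * enorm (perp_part s c) ^+ 2) = 0)) /\
  (rotation g <> 1%:M ->
     forall s : 'cV[R]_3, enorm s = 1 -> rotation g *m s = s ->
     (Q *m s = s /\ parallel c s) /\
     dotv s (A hgam) = dotv s (Q *m A gamma) /\
     dotv s (V hgam) =
       dotv s (Q *m V gamma + crossv c (Q *m A gamma))).
Proof.
move=> b Q c A V hgam.
have [[sm imm] equiv] := hgamma.
have dF : coord_derive gamma (derive1 gamma) := derive1_coord_derive (sm 0%N).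
have dF' : coord_derive (derive1 gamma) (derive1 (derive1 gamma)) :=
  derive1_coord_derive (sm 1%N).
have := area_vector_act t0 hT0 dF dF' imm g h.
have := volume_vector_act t0 hT0 dF dF' imm g h.
rewrite -/b -/Q -/c -/hgam -/(A hgam) -/(A gamma) -/(V hgam) -/(V gamma).
rewrite equiv /SE3_act -/b => eV eA.
have [QR eb] := (centralizerP g h).1 hh; rewrite -/Q -/c -/b in QR eb.
split; last split.
- move=> gid; have b0 : b = 0 by rewrite /b gid.
  have R1 : rotation g = 1%:M by rewrite gid.
  split=> [k|].
    by apply/centralizerP; rewrite -/b b0 R1 mulmx1 !mul1mx mulmx0 add0r addr0.
  rewrite eA eV R1 b0 mul1mx addr0 mulmx0.
  by split; move: (Q *m gamma t0) (Q *m A gamma) => x a;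
    rewrite ?subrr ?mulmx0; vec_ring.
- move=> R1 bn0; set s := (enorm b)^-1 *: b.
  have [s1 bs] := enorm_normalize bn0; rewrite -/s in s1 bs.
  have nb0 : enorm b != 0 by apply/eqP => /enorm_eq0.
  have cent k : centralizer g k <-> rotation k *m b = b.
    split=> [/centralizerP[_]|kb].
      by rewrite R1 mul1mx addrC => /addrI.
    by apply/centralizerP; rewrite R1 mulmx1 !mul1mx -/b kb addrC.
  have Qb := (cent h).1 hh; rewrite -/Q in Qb.
  split.
    move=> k; apply: iff_trans (cent k) _; rewrite /s -scalemxAr.
    by split=> [->//|/scalerI]; apply; rewrite invr_eq0.
  rewrite eA eV R1 mul1mx mulmxDr Qb; split; [|split].
  + congr (_ + _).
    rewrite [gamma t0 + b]addrC addrK Qb; move: (Q *m gamma t0) => x.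
    by apply: cV3P; rewrite !coordE; field.
  + rewrite dotvDr; congr (_ + _).
    rewrite {1 2 3 4}bs; exact: volume_defect_translation.
  + move=> [a ca]; split; first by rewrite ca {1}bs; vec_ring.
    rewrite enorm_sqr ca /perp_part dotvZr s1 mulr1 subrr.
    by rewrite dotvE !zerovE; ring.
- move=> R1 s /enorm1_dotv s1 Rs.
  have Rb := (screw_axis0 g).1 (horigin R1).
  have [bs Qs cs] := centralizer_screw_motion hturn R1 Rb s1 Rs hh.
  rewrite -/b -/Q -/c in bs Qs cs.
  have Qb : Q *m b = b by rewrite bs -scalemxAr Qs.
  split; first by split=> //; exists (dotv s c).
  rewrite eA eV Qb; split.
    rewrite dotvDr cs bs; move: (Q *m gamma t0) (Q *m (_ - _)) => x y.
    by rewrite [X in _ + X](_ : _ = 0) ?addr0// !dotvE !coordE; ring.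
  (* The b inside the end point stays folded so that Qs and Rs apply to the side
     condition: the screw motion g preserves the distance to the axis, and so
     does Q. *)
  rewrite dotvDr cs {2 3 4}bs volume_defect_screw// ?addr0//.
  have hR := rotation_SO3 g; have hQ := rotation_SO3 h.
  rewrite !(SO3_dotv_fixed _ hQ Qs) !(SO3_dotv _ _ hQ).
  rewrite bs !dotE (SO3_dotv_fixed _ hR Rs) (SO3_dotv _ _ hR).
  rewrite (dotvC _ s) (SO3_dotv_fixed _ hR Rs) s1.
  ring.
Qed.
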